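(* Let $v:B\to B$ be an injective function and let $A\subseteq B$ be a non-empty subset. Suppose $h:A\to A$ is a function such that $h(a)=v(a)$ for every $a\in A$ with $v(a)\in A$. Suppose $A=A_2\setminus A_1$ where $A_1,A_2\subseteq B$ are invariant under $v$ (that is, $v(A_1)\subseteq A_1$ and $v(A_2)\subseteq A_2$). Then there exists $p:B\to B$ such that $p^2=p$, $p(B)=A$ and $$p(v^n(a))=h^n(a)\quad\text{for all } n\in\mathbb{Z}_+,\ a\in A.$$
   Context: $\mathbb{Z}_+=\{0,1,2,\ldots\}$; for any self-map $f$, $f^0$ is the identity. *)

(* Defs.v *)
From mathcomp Require Export all_boot.
From mathcomp Require Export boolp classical_sets.

(* Main.v *)
Require Import Defs.
From mathcomp Require Import all_boot.
From mathcomp Require Import boolp classical_sets.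
Set Implicit Arguments.
Unset Strict Implicit.
Unset Printing Implicit Defensive.
Local Open Scope classical_set_scope.

(** The condition [p (v^n a) = h^n a] prescribes [p] on the forward [v]-orbits
    of points of [A]; elsewhere [p] may take any value in [A].  Everything rests
    on the prescription being consistent.  If [v^n a = v^m a'] with [n <= m],
    injectivity gives [a = v^(m-n) a'], so the [v]-orbit of [a'] is in [A] at
    times [0] and [m-n].  An orbit cannot leave [A = A2 \ A1] and return: it
    never leaves [A2], and it never leaves [A1] once there.  Hence it stays in
    [A] in between, where [h] and [v] agree, so [a = h^(m-n) a'] and
    [h^n a = h^m a'] ([iter_h_eq]).  The case [n = 0] of the prescription says
    that [p] fixes [A] pointwise, so that [p] is a projection onto [A]. *)

Lemma iter_inj (T : Type) (f : T -> T) (n : nat) :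
  injective f -> injective (iter n f).
Proof. by move=> finj; elim: n => [//|n IHn] x y /= /finj /IHn. Qed.

Section Orbits.
Variables (B : Type) (v : B -> B) (A : set B) (h : A -> A) (A1 A2 : set B).
Hypothesis h_v : forall a : A, v (\val a) \in A -> \val (h a) = v (\val a).
Hypothesis A_eq : A = A2 `\` A1.
Hypothesis A1_inv : v @` A1 `<=` A1.
Hypothesis A2_inv : v @` A2 `<=` A2.

Lemma iter_in_A2 (n : nat) (a : A) : A2 (iter n v (\val a)).
Proof.
elim: n => [|n IHn] /=; last by apply: A2_inv; exists (iter n v (\val a)).
by have := set_mem (valP a); rewrite [X in X _]A_eq => -[].
Qed.

(** Every orbit from [A] stays in [A2], so the only exit from [A] is into [A1],
    from which there is no return. *)
Lemma iter_in_pred (n : nat) (a : A) :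
  A (iter n.+1 v (\val a)) -> A (iter n v (\val a)).
Proof.
rewrite [X in X _ -> _]A_eq [X in _ -> X _]A_eq => -[_ notA1]; split; first exact: iter_in_A2.
by move=> inA1; apply: notA1; apply: A1_inv; exists (iter n v (\val a)).
Qed.

(** An orbit that is in [A] at time [n] has been there at all earlier times, so
    [h] has followed [v] all along. *)
Lemma iter_h_v (n : nat) (a : A) :
  A (iter n v (\val a)) -> \val (iter n h a) = iter n v (\val a).
Proof.
elim: n => [//|n IHn] inA.
have hn := IHn (iter_in_pred inA).
by rewrite /= h_v hn //; apply: mem_set.
Qed.

Hypothesis v_inj : injective v.

(** Consistency of the prescription for [p].  Cancelling the common iterates
    of [v] puts the two starting points on one orbit, to which [iter_h_v]
    applies. *)
Lemma iter_h_eq (n m : nat) (a b : A) :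
  iter n v (\val a) = iter m v (\val b) -> iter n h a = iter m h b.
Proof.
wlog le_nm : n m a b / n <= m => [hwlog|].
  have [/hwlog|/ltnW le_mn] := leqP n m; first exact.
  by move=> /esym /(hwlog _ _ _ _ le_mn) ->.
rewrite -(subnKC le_nm) !iterD => /(iter_inj v_inj) a_eq; congr iter.
apply: val_inj; rewrite iter_h_v // -a_eq; exact: set_mem (valP a).
Qed.

End Orbits.

Theorem theorem1p18 (B : Type) (v : B -> B) (A : set B) (h : A -> A)
    (A1 A2 : set B) :
  injective v ->
  A !=set0 ->
  (forall a : A, v (\val a) \in A -> \val (h a) = v (\val a)) ->
  A = A2 `\` A1 ->
  v @` A1 `<=` A1 ->
  v @` A2 `<=` A2 ->
  exists p : B -> B,
    [/\ p \o p = p,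
        range p = A
      & forall (n : nat) (a : A), p (iter n v (\val a)) = \val (iter n h a)].
Proof.
move=> v_inj [a0 Aa0] h_v A_eq A1_inv A2_inv.
have /choice[p p_spec] : forall b, exists c, A c /\
    forall n (a : A), iter n v (\val a) = b -> c = \val (iter n h a).
  move=> b; have [[n [a na]]|none] :=
    pselect (exists n (a : A), iter n v (\val a) = b).
    exists (\val (iter n h a)); split; first exact: set_mem (valP _).
    move=> m a' ma'; congr (\val _).
    by apply: (iter_h_eq h_v A_eq A1_inv A2_inv v_inj); rewrite na ma'.
  by exists a0; split=> // n a na; case: none; exists n, a.
have pA b : A (p b) by have [] := p_spec b.
have p_iter n (a : A) : p (iter n v (\val a)) = \val (iter n h a).
  by have [_] := p_spec (iter n v (\val a)); apply.
have p_id b : A b -> p b = b.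
  by move=> Ab; exact: (p_iter 0 (exist _ b (mem_set Ab))).
exists p; split=> //; first by apply/funext => b /=; rewrite p_id.
apply/seteqP; split=> [_ [b _ <-] //|b Ab]; by exists b; rewrite ?p_id.
Qed.
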